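(* Let $X$ be an infinite-dimensional complex Banach space. 1. Let $T\in L(X)$ be an operator for which $\sigma_{ap}(T)=\partial\sigma(T)$ and every $\lambda\in\partial\sigma(T)$ is not isolated in $\sigma(T)$. Then $\sigma_{ap}(T)=\sigma_{TUD}(T)$. 2. Let $T\in L(X)$ be an operator for which $\sigma_{su}(T)=\partial\sigma(T)$ and every $\lambda\in\partial\sigma(T)$ is not isolated in $\sigma(T)$. Then $\sigma_{su}(T)=\sigma_{TUD}(T)$.
   Context: $L(X)$ is the algebra of bounded linear operators on $X$; $\sigma(T)$, $\sigma_{ap}(T)$, $\sigma_{su}(T)$ are the spectrum, approximate point spectrum ($T-\lambda I$ not bounded below) and surjective spectrum ($T-\lambda I$ not surjective); $\partial$ denotes the boundary in $\mathbb{C}$; $\mathbb{N}_0=\{0,1,2,\dots\}$; $N(T)$, $R(T)$ are the null space and range. Let $k_n(T)=\dim (R(T^n)\cap N(T))/(R(T^{n+1})\cap N(T))$. $T$ has topological uniform descent (TUD) if there is $d\in\mathbb{N}_0$ with $k_n(T)=0$ for all $n\ge d$ and, for all $n\ge d$, $R(T^n)$ closed in $R(T^d)$ with respect to the norm $\|y\|_d=\inf\{\|x\|:x\in X,\ y=T^dx\}$; $\sigma_{TUD}(T)$ is the set of $\lambda\in\mathbb{C}$ such that $T-\lambda I$ does not have TUD. *)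

(* Defs.v *)
From HB Require Import structures.
From mathcomp Require Import all_boot all_order all_algebra.
From mathcomp.real_closed Require Import complex.
From mathcomp Require Import all_classical all_reals all_analysis.

Set Implicit Arguments.
Unset Strict Implicit.
Unset Printing Implicit Defensive.

Import Order.TTheory GRing.Theory Num.Theory.
Import numFieldNormedType.Exports.

Local Open Scope classical_set_scope.
Local Open Scope ring_scope.
Local Open Scope complex_scope.

(* [R[i]] under the type of its [numFieldType] structure: this is where the
   topology that the library attaches to every [numFieldType] is found. *)
Definition complex_field (R : realType) : numFieldType := R[i].

Section Operators.
Variables (R : realType) (X : completeNormedModType R[i]).
Implicit Types (T A S : {linear X -> X}) (lambda : complex_field R).
Implicit Types (V W : set X).

Definition bounded_operator A : Prop :=
  exists M : R, forall x, `|A x| <= M%:C * `|x|.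

Definition shift T lambda : {linear X -> X} := T \- lambda \*: idfun.

(* Invertibility is meant in the algebra of bounded operators. *)
Definition invertible A : Prop :=
  exists S : {linear X -> X}, [/\ bounded_operator S, cancel A S & cancel S A].

Definition bounded_below A : Prop :=
  exists2 c : R, 0 < c & forall x, c%:C * `|x| <= `|A x|.

Definition spectrum T : set (complex_field R) :=
  [set lambda | ~ invertible (shift T lambda)].

Definition approximate_point_spectrum T : set (complex_field R) :=
  [set lambda | ~ bounded_below (shift T lambda)].

Definition surjective_spectrum T : set (complex_field R) :=
  [set lambda | ~ set_surj [set: X] [set: X] (shift T lambda)].

Definition power_range T n : set X := range (iter n T).

Definition null_space T : set X := [set x | T x = 0].

(* Dimension of [V / W] for subspaces [W `<=` V]: the supremum in [0, +oo] of
   the lengths of families in [V] that are linearly independent modulo [W]. *)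
Definition quotient_dim V W : \bar R :=
  ereal_sup [set n%:R%:E | n in [set n : nat |
    exists v : 'I_n -> X, (forall i, V (v i)) /\
      forall c : 'I_n -> R[i], W (\sum_i c i *: v i) -> forall i, c i = 0]].

(* The number [k_n(T)]. *)
Definition descent_dim n T : \bar R :=
  quotient_dim (power_range T n `&` null_space T)
               (power_range T n.+1 `&` null_space T).

(* Norms on [X] take values in [R[i]], hence the real part.  The value is
   meaningful for [y] in the range of [T ^ d] only. *)
Definition range_norm T d (y : X) : R :=
  inf [set complex.Re `|x| | x in [set x | y = iter d T x]].

(* [R(T^n)] is closed in the space [R(T^d)] normed by [range_norm T d]. *)
Definition range_closed_in T n d : Prop :=
  forall y, power_range T d y ->
    (forall e : R, 0 < e ->
       exists2 z, power_range T n z & range_norm T d (y - z) < e) ->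
    power_range T n y.

Definition topological_uniform_descent T : Prop :=
  exists d : nat,
    (forall n, (d <= n)%N -> descent_dim n T = 0%E) /\
    (forall n, (d <= n)%N -> range_closed_in T n d).

Definition TUD_spectrum T : set (complex_field R) :=
  [set lambda | ~ topological_uniform_descent (shift T lambda)].

End Operators.

Definition infinite_dimensional (R : realType) (X : completeNormedModType R[i])
    : Prop :=
  quotient_dim [set: X] [set 0] = +oo%E.

Definition boundary (U : topologicalType) (B : set U) : set U :=
  closure B `\` interior B.

(* Main.v *)
From HB Require Import structures.
Require Import Defs.
From mathcomp Require Import all_boot all_order all_algebra.
From mathcomp.real_closed Require Import complex.
From mathcomp Require Import all_classical all_reals all_analysis.
From mathcomp Require Import ring lra.

Set Implicit Arguments.
Unset Strict Implicit.
Unset Printing Implicit Defensive.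

Import Order.TTheory GRing.Theory Num.Theory.
Import numFieldNormedType.Exports.

Local Open Scope classical_set_scope.
Local Open Scope ring_scope.
Local Open Scope complex_scope.

(** The inclusions of the TUD spectrum in the other two are soft: for [S] bounded
    below every [R(S^n)] is closed and [N(S) = 0], for [S] onto every [R(S^n)]
    is the whole space, and in both cases [S] has uniform descent with [d = 0].

    The other inclusions both follow from one fact, a special case of
    Grabiner's punctured neighbourhood theorem: if [S = T - lambda] has uniform
    descent and [S - mu] is invertible for arbitrarily small [mu], then [S - mu]
    is invertible for all small [mu <> 0].  Hence a point of the spectrum that
    is a boundary point and at which [T] has uniform descent is isolated.

    To see the fact, let [Y = R(S^d)] with the quotient norm of [X / N(S^d)].
    On this Banach space the restriction of [S] has closed range and its kernel
    lies in the range of every power of it.  If [S y = 0] with [y <> 0] in [Y],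
    the open mapping theorem gives a chain [y = y_0], [S y_(n+1) = y_n], of at
    most geometric growth, and the sum of the [mu^n y_n] is an element of
    [N(S - mu)], nonzero for all small [mu]; this contradicts the invertibility
    of some of the [S - mu] ([kernel_bound], [restriction_injective]).  So the
    restriction of [S] is bounded below, hence so are its small perturbations,
    uniformly, and surjectivity spreads from one of them to the others by a
    Neumann series.  Finally, for [mu <> 0], bijectivity of [S - mu] passes from
    [Y] to [X] because [S] is nilpotent on [N(S^d)] ([shift_invertible]).

    The space [Y] is never built: its vectors are written [D u] with
    [D = S^d] and [u] in [X], and a bound on the norm of [D u] in [Y] is stated
    as the existence of a [v] with [D v = D u] and the corresponding bound on
    the norm of [v] in [X]. *)

(* The topology library has a translation map of the same name. *)
Local Notation shift := Defs.shift.

(** * Real-valued norms and geometric convergence *)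

Section RealNorm.
Variables (R : realType) (V : normedModType R[i]).
Implicit Types (x y : V) (a : R[i]).

(** The norms of [X] and of [R[i]] take values in [R[i]]; their real parts can
    be used with infima and with linear arithmetic. *)
Definition rnorm {W : normedZmodType R[i]} (x : W) : R := complex.Re `|x|.

Lemma rnormE {W : normedZmodType R[i]} (x : W) : `|x| = (rnorm x)%:C.
Proof. by rewrite RRe_real // ger0_real. Qed.

Lemma rnorm_ge0 {W : normedZmodType R[i]} (x : W) : 0 <= rnorm x.
Proof. by rewrite -ler0c -rnormE. Qed.

Lemma rnorm0 : rnorm (0 : V) = 0.
Proof. by rewrite /rnorm normr0. Qed.

Lemma rnorm_eq0 {W : normedZmodType R[i]} (x : W) : rnorm x = 0 -> x = 0.
Proof. by move=> h; apply/eqP; rewrite -normr_eq0 rnormE h. Qed.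

Lemma rnormN x : rnorm (- x) = rnorm x.
Proof. by rewrite /rnorm normrN. Qed.

Lemma rnormC x y : rnorm (x - y) = rnorm (y - x).
Proof. by rewrite -rnormN opprB. Qed.

Lemma ler_rnormD {W : normedZmodType R[i]} (x y : W) :
  rnorm (x + y) <= rnorm x + rnorm y.
Proof. by rewrite -lecR rmorphD /= -!rnormE ler_normD. Qed.

Lemma ler_rnormB x y : rnorm (x - y) <= rnorm x + rnorm y.
Proof. by rewrite -(rnormN y) ler_rnormD. Qed.

Lemma rnormZ a x : rnorm (a *: x) = rnorm a * rnorm x.
Proof.
by rewrite /rnorm normrZ !rnormE -rmorphM.
Qed.

End RealNorm.

Lemma ler_half_pow (R : realType) (a b K : R) :
  (forall n, a <= b + K * 2^-1 ^+ n) -> a <= b.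
Proof.
move=> h; apply/ler_addgt0Pr => e e0.
have K0 : 0 < `|K| + 1 by rewrite ltr_wpDl.
have [n hn] : exists n, (`|K| + 1) / e < 2 ^+ n.
  exists (Num.bound ((`|K| + 1) / e)).
  have/archi_boundP/lt_trans : 0 <= (`|K| + 1) / e by rewrite divr_ge0 // ltW.
  by apply; rewrite -natrX ltr_nat ltn_expl.
apply: (le_trans (h n)); rewrite lerD2l exprVn ler_pdivrMr ?exprn_gt0 //.
rewrite mulrC -ler_pdivrMr //; apply/ltW/(le_lt_trans _ hn).
rewrite ler_pM2r ?invr_gt0 //.
by apply: le_trans (ler_norm K) _; rewrite lerDl.
Qed.

Section Operators.
Variables (R : realType) (X : completeNormedModType R[i]).

(** The only form in which completeness of [X] is used.  The explicit rate of
    convergence makes every later passage to the limit an application of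
    [ler_half_pow]. *)
Lemma geometric_limit (s : nat -> X) (K : R) :
  (forall n, rnorm (s n.+1 - s n) <= K * 2^-1 ^+ n) ->
  exists l, forall n, rnorm (l - s n) <= 2 * K * 2^-1 ^+ n.
Proof.
move=> h.
have hd n m : rnorm (s (m + n)%N - s n) <= 2 * K * (2^-1 ^+ n - 2^-1 ^+ (m + n)).
  elim: m => [|m IH]; first by rewrite add0n !subrr mulr0 rnorm0.
  rewrite addSn; set q := (m + n)%N in IH *.
  have -> : s q.+1 - s n = (s q.+1 - s q) + (s q - s n) by rewrite addrA subrK.
  apply: le_trans (ler_rnormD _ _) _; have := h q; move: IH.
  rewrite exprS; set r := 2^-1 ^+ q.
  by move=> IH hq; apply: le_trans (lerD hq IH) _; apply/eqP/eqP; lra.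
have K0 : 0 <= K.
  by have := h 0%N; rewrite expr0 mulr1; apply/le_trans/rnorm_ge0.
have hd2 n m : (n <= m)%N -> rnorm (s m - s n) <= 2 * K * 2^-1 ^+ n.
  move=> nm; rewrite -(subnK nm); apply: le_trans (hd _ _) _.
  rewrite ler_wpM2l ?mulr_ge0 // gerBl exprn_ge0 //; lra.
have small (e : R) : 0 < e -> exists n, 2 * K * 2^-1 ^+ n < e.
  move=> e0; apply: contrapT => hn.
  have : e <= 0.
    apply: (@ler_half_pow _ _ _ (2 * K)) => n; rewrite add0r leNgt.
    by apply/negP => hh; apply: hn; exists n.
  by rewrite leNgt e0.
have cs : cvg (s @ \oo).
  apply/cauchy_cvgP/cauchy_exP => e e0.
  have eE : e = (complex.Re e)%:C by rewrite RRe_real // ger0_real // ltW.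
  have re0 : 0 < complex.Re e by move: e0; rewrite {1}eE ltcR.
  have [n hn] := small _ re0.
  exists (s n); exists n => // m /= nm.
  rewrite -ball_normE /= eE rnormE ltcR rnormC; exact: le_lt_trans (hd2 _ _ nm) hn.
have [l hl] := (cvg_ex _).1 cs; exists l => n.
apply/ler_addgt0Pr => e e0.
move/cvgrPdist_lt: hl => /(_ e%:C); rewrite ltcR => /(_ e0)[N _ hN].
have := hN (maxn N n) (leq_maxl _ _); rewrite rnormE ltcR => h1.
have -> : l - s n = (l - s (maxn N n)) + (s (maxn N n) - s n).
  by rewrite addrA subrK.
apply: le_trans (ler_rnormD _ _) _.
by apply: le_trans (lerD (ltW h1) (hd2 n _ (leq_maxr N n))) _; rewrite addrC.
Qed.

Implicit Types (A D S : {linear X -> X}) (M : set X).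

Lemma bounded_operatorP A : bounded_operator A ->
  exists2 M : R, 0 <= M & forall x, rnorm (A x) <= M * rnorm x.
Proof.
move=> [M hM]; exists `|M| => // x.
have := hM x; rewrite !rnormE -rmorphM lecR => h; apply: le_trans h _.
by rewrite ler_wpM2r ?rnorm_ge0 // ler_norm.
Qed.

Lemma rnorm_bounded_operator A (M : R) :
  (forall x, rnorm (A x) <= M * rnorm x) -> bounded_operator A.
Proof. by move=> h; exists M => x; rewrite !rnormE -rmorphM lecR. Qed.

(** If [A v = D u] can be solved within [P] up to halving the error, with control
    of [v], then it can be solved exactly: sum the corrections.  This is
    the last step of the open mapping theorem (errors are small by density), and
    also the Neumann series (errors are small by perturbation). *)
Lemma successive_approximation A D (P : set X) (c : R) :
  bounded_operator A -> bounded_operator D -> 0 <= c ->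
  (forall (K : R) u, 0 < K -> P u -> rnorm u <= K ->
     exists v u' : X, [/\ rnorm v <= c * K, P u', rnorm u' <= K / 2
                    & A v = D (u - u')]) ->
  forall (K : R) u, 0 < K -> P u -> rnorm u <= K ->
    exists2 v, A v = D u & rnorm v <= 2 * c * K.
Proof.
move=> /bounded_operatorP[MA MA0 hA] /bounded_operatorP[MD MD0 hD] c0 step.
move=> K u K0 Pu uK.
pose KK n : R := K * 2^-1 ^+ n.
have KK0 n : 0 < KK n by rewrite mulr_gt0 // exprn_gt0 // invr_gt0.
(* A pair holds the current error and the sum of the corrections so far. *)
pose Q n (p q : X * X) :=
  P p.1 /\ rnorm p.1 <= KK n ->
  [/\ P q.1, rnorm q.1 <= KK n.+1, rnorm (q.2 - p.2) <= c * KK n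
    & A (q.2 - p.2) = D (p.1 - q.1)].
have next n p : exists q, Q n p q.
  have [[Pp pK]|hp] := pselect (P p.1 /\ rnorm p.1 <= KK n); last first.
    by exists p => /hp.
  have [v [u' [h1 h2 h3 h4]]] := step _ _ (KK0 n) Pp pK.
  exists (u', p.2 + v) => _ /=; rewrite addrAC subrr add0r; split => //.
  by apply: le_trans h3 _; rewrite /KK exprS; lra.
have [f hf] := choice (fun np : nat * (X * X) => next np.1 np.2).
pose p := fix p n := if n is m.+1 then f (m, p m) else (u, 0 : X).
have inv n : P (p n).1 /\ rnorm (p n).1 <= KK n.
  elim: n => [|n IH] /=; first by rewrite /KK expr0 mulr1.
  by have [] := hf (n, p n) IH.
have st n := hf (n, p n) (inv n).
have tele n : A (p n).2 = D (u - (p n).1).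
  elim: n => [|n IH]; first by rewrite /= subrr !linear0.
  have [_ _ _] := st n; rewrite -/(p n.+1) /=.
  rewrite -[f _]/(p n.+1) linearB IH => /(canRL (subrK _)) ->.
  by rewrite -[in RHS](subrKA (p n).1 u) [in RHS]linearD addrC.
have [|l hl] := @geometric_limit (fun n => (p n).2) (c * K).
  by move=> n; have [_ _ + _] := st n; rewrite /KK mulrA.
exists l; last by have := hl 0%N; rewrite /= subr0 expr0 mulr1 mulrA.
apply/eqP; rewrite -subr_eq0; apply/eqP/rnorm_eq0/le_anti; rewrite rnorm_ge0 andbT.
apply: (@ler_half_pow _ _ _ (MA * (2 * (c * K)) + MD * K)) => n.
have -> : A l - D u = A (l - (p n).2) - D (p n).1.
  by rewrite linearB tele linearB opprB addrA addrAC addrK.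
rewrite add0r mulrDl; apply: le_trans (ler_rnormB _ _) _; apply: lerD.
  by apply: le_trans (hA _) _; rewrite -mulrA ler_wpM2l.
by apply: le_trans (hD _) _; rewrite -mulrA ler_wpM2l //; have [] := inv n.
Qed.

(** * Category and open mappings *)

Definition rclosed M :=
  forall u, (forall e : R, 0 < e -> exists2 z, M z & rnorm (u - z) < e) -> M u.

(** Baire's theorem on the complete metric subspace [M]: were every [F k] nowhere
    dense in [M], shrinking balls could avoid them one after the other, and the
    limit of the centres would be in no [F k]. *)
Lemma baire_closed M (F : nat -> set X) :
  rclosed M -> M !=set0 -> (forall u, M u -> exists k, F k u) ->
  exists k u0 (r : R), [/\ 0 < r, M u0 & forall u, M u -> rnorm (u - u0) <= r ->
    forall e : R, 0 < e -> exists2 z, F k z & rnorm (u - z) < e].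
Proof.
move=> clM [m0 Mm0] cov; apply: contrapT => hno.
(* A pair is a centre and a radius. *)
pose Q k (p q : X * R) := M p.1 /\ 0 < p.2 ->
  [/\ M q.1, 0 < q.2, rnorm (q.1 - p.1) <= p.2 / 2, q.2 <= p.2 / 2
    & forall z, F k z -> 2 * q.2 <= rnorm (q.1 - z)].
have next k p : exists q, Q k p q.
  have [[Mp p0]|hp] := pselect (M p.1 /\ 0 < p.2); last by exists p => /hp.
  apply: contrapT => hq; apply: hno; exists k, p.1, (p.2 / 2).
  split=> // [|u Mu up e e0]; first by rewrite divr_gt0.
  apply: contrapT => hz; apply: hq.
  exists (u, Num.min (e / 2) (p.2 / 2)) => _ /=.
  split=> //; first by rewrite lt_min !divr_gt0.
    by rewrite ge_min lexx orbT.
  move=> z Fz; rewrite leNgt; apply/negP => hlt; apply: hz; exists z => //.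
  apply: lt_le_trans hlt _; rewrite mulrC -ler_pdivlMr //.
  by rewrite ge_min lexx.
have [f hf] := choice (fun np : nat * (X * R) => next np.1 np.2).
pose p := fix p n := if n is m.+1 then f (m, p m) else (m0, 1 : R).
have inv n : M (p n).1 /\ 0 < (p n).2.
  by elim: n => [|n IH] //=; have [] := hf (n, p n) IH.
have st n : [/\ M (p n.+1).1, 0 < (p n.+1).2,
    rnorm ((p n.+1).1 - (p n).1) <= (p n).2 / 2, (p n.+1).2 <= (p n).2 / 2
    & forall z, F n z -> 2 * (p n.+1).2 <= rnorm ((p n.+1).1 - z)].
  exact: hf (n, p n) (inv n).
have dec m n : (p (n + m)%N).2 <= (p m).2 * 2^-1 ^+ n.
  elim: n => [|n IH]; first by rewrite expr0 mulr1.
  have [_ _ _ h _] := st (n + m)%N; apply: le_trans h _.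
  by rewrite exprS; lra.
have [|l hl] := @geometric_limit (fun n => (p n).1) (2^-1).
  move=> n; have [_ _ h _ _] := st n; apply: le_trans h _.
  by have := dec 0%N n; rewrite addn0 /=; lra.
have Ml : M l.
  apply: clM => e e0; apply: contrapT => hz.
  have : e <= 0.
    apply: (@ler_half_pow _ _ _ (2 * 2^-1)) => n; rewrite add0r leNgt.
    apply/negP => hh; apply: hz; exists (p n).1; first by have [] := inv n.
    exact: le_lt_trans (hl n) hh.
  by rewrite leNgt e0.
have [k Fk] := cov _ Ml.
have [_ pk0 _ _ /(_ _ Fk) far] := st k.
suff : rnorm ((p k.+1).1 - l) <= (p k.+1).2 by lra.
have near m n : rnorm ((p m).1 - (p (n + m)%N).1) <= (p m).2 * (1 - 2^-1 ^+ n).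
  elim: n => [|n IH]; first by rewrite expr0 !subrr mulr0 rnorm0.
  have [_ _ h _ _] := st (n + m)%N; have := dec m n; rewrite addSn.
  have -> : (p m).1 - (p (n + m).+1).1 =
    ((p m).1 - (p (n + m)%N).1) - ((p (n + m).+1).1 - (p (n + m)%N).1).
    by rewrite opprB addrA subrK.
  move=> hd; apply: le_trans (ler_rnormB _ _) _; rewrite exprS; lra.
apply: (@ler_half_pow _ _ _ 1) => n.
have -> : (p k.+1).1 - l =
    ((p k.+1).1 - (p (n + k.+1)%N).1) - (l - (p (n + k.+1)%N).1).
  by rewrite opprB addrA subrK.
apply: le_trans (ler_rnormB _ _) _; apply: lerD.
  apply: le_trans (near _ _) _; apply: ler_piMr; first exact: ltW.
  by rewrite gerBl exprn_ge0 // invr_ge0.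
apply: le_trans (hl _) _.
rewrite mulfV // !mul1r exprD ler_piMr ?exprn_ge0 ?invr_ge0 //.
by rewrite exprn_ile1 ?invr_ge0 // invf_le1 // ler1n.
Qed.

(** An open mapping theorem for the relation [A v = D u].  With [D] the identity
    it is the usual one; with [A = S^(d+1)] and [D = S^d] it is the one for
    the restriction of [S] to [R(S^d)], pulled back to [X]. *)
Lemma open_mapping A D :
  bounded_operator A -> bounded_operator D ->
  rclosed [set u | exists v, A v = D u] ->
  exists2 C : R, 0 < C &
    forall u, (exists v, A v = D u) ->
      exists2 v, A v = D u & rnorm v <= C * rnorm u.
Proof.
move=> bA bD; set M := [set u | _] => clM.
have MB x y : M x -> M y -> M (x - y).
  by move=> [v hv] [w hw]; exists (v - w); rewrite !linearB hv hw.
have MZ a x : M x -> M (a *: x).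
  by move=> [v hv]; exists (a *: v); rewrite !linearZ hv.
pose F k := [set u | exists2 v, A v = D u & rnorm v <= k%:R].
have [| |k [u0 [r [r0 Mu0 dense]]]] := @baire_closed M F clM.
- by exists 0, 0; rewrite !linear0.
- move=> u [v hv]; exists (Num.bound (rnorm v)), v => //.
  by rewrite ltW // archi_boundP // rnorm_ge0.
(* Differences of two elements of [F k] have solutions of norm at most [2 k],
   and they are dense in the ball of [M] of radius [r] around 0. *)
pose c : R := 2 * k%:R / r.
have c0 : 0 <= c by rewrite divr_ge0 ?mulr_ge0 // ltW.
have step (K : R) u : 0 < K -> M u -> rnorm u <= K ->
     exists v u' : X, [/\ rnorm v <= c * K, M u', rnorm u' <= K / 2
                    & A v = D (u - u')].
  move=> K0 Mu uK; pose t : R := r / K; have t0 : 0 < t by rewrite divr_gt0.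
  have nt : rnorm (t%:C : R[i]) = t.
    by rewrite /rnorm ger0_norm // ler0c ltW.
  have e0 : 0 < t * (K / 2 / 2) by rewrite mulr_gt0 // !divr_gt0.
  have Mtu := MZ t%:C _ Mu.
  have Mtu0 : M (t%:C *: u + u0).
    by rewrite -[u0]opprK; apply: MB => //; rewrite -scaleN1r; apply: MZ.
  have [|z1 [v1 hv1 nv1] nz1] := dense _ Mtu0 _ _ e0.
    by rewrite addrK rnormZ nt /t mulrAC ler_pdivrMr // ler_wpM2l // ltW.
  have [|z2 [v2 hv2 nv2] nz2] := dense _ Mu0 _ _ e0.
    by rewrite subrr rnorm0 ltW.
  pose z := (t^-1)%:C *: (z1 - z2).
  have nti : rnorm ((t^-1)%:C : R[i]) = t^-1.
    by rewrite /rnorm ger0_norm // ler0c invr_ge0 ltW.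
  have Av : A ((t^-1)%:C *: (v1 - v2)) = D z by rewrite !linearZ !linearB hv1 hv2.
  exists ((t^-1)%:C *: (v1 - v2)), (u - z); split.
  - have -> : c * K = t^-1 * (k%:R + k%:R) by rewrite /c /t invf_div; ring.
    rewrite rnormZ nti ler_wpM2l ?invr_ge0 ?(ltW t0) //.
    by apply: le_trans (ler_rnormB _ _) _; apply: lerD.
  - by apply: MB => //; exists ((t^-1)%:C *: (v1 - v2)).
  - have -> : u - z = (t^-1)%:C *: ((t%:C *: u + u0 - z1) - (u0 - z2)).
      rewrite (_ : t%:C *: u + u0 - z1 - (u0 - z2) = t%:C *: u - (z1 - z2)).
        by rewrite [RHS]scalerBr scalerA -rmorphM mulVf ?gt_eqF // scale1r.
      rewrite !opprB !addrA (addrAC _ u0 (- z1)) (addrAC _ u0 z2) addrK.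
      by rewrite addrAC.
    rewrite rnormZ nti ler_pdivrMl //.
    have -> : t * (K / 2) = t * (K / 2 / 2) + t * (K / 2 / 2) by field.
    by apply: le_trans (ler_rnormB _ _) _; apply: lerD; apply: ltW.
  - by rewrite Av opprB addrC subrK.
have C0 : 0 < 2 * c + 1 by lra.
exists (2 * c + 1) => // u Mu.
have [->|u0'] := eqVneq u 0; first by exists 0; rewrite ?linear0 // rnorm0 mulr0.
have nu0 : 0 < rnorm u.
  rewrite lt_def rnorm_ge0 andbT; apply: contra u0' => /eqP h.
  exact/eqP/rnorm_eq0.
have [v hv nv] := successive_approximation bA bD c0 step nu0 Mu (lexx _).
by exists v => //; apply: le_trans nv _; rewrite ler_wpM2r ?rnorm_ge0 // lerDl.
Qed.

(** * Powers, shifts and inverses of bounded operators *)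

Lemma bounded_comp A D :
  bounded_operator A -> bounded_operator D -> bounded_operator (A \o D).
Proof.
move=> /bounded_operatorP[MA MA0 hA] /bounded_operatorP[MD MD0 hD].
apply: (@rnorm_bounded_operator _ (MA * MD)) => x /=.
by apply: le_trans (hA _) _; rewrite -mulrA ler_wpM2l.
Qed.

Lemma bounded_id : bounded_operator (idfun : {linear X -> X}).
Proof. by apply: (@rnorm_bounded_operator _ 1) => x; rewrite mul1r. Qed.

Lemma shiftE S (mu : R[i]) x : shift S mu x = S x - mu *: x.
Proof. by []. Qed.

Lemma bounded_shift S (mu : R[i]) :
  bounded_operator S -> bounded_operator (shift S mu).
Proof.
move=> /bounded_operatorP[M M0 hM].
apply: (@rnorm_bounded_operator _ (M + rnorm mu)) => x; rewrite shiftE mulrDl.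
by apply: le_trans (ler_rnormB _ _) _; rewrite rnormZ lerD2r.
Qed.

Lemma bounded_inverse A :
  bounded_operator A -> injective A -> (forall y, exists x, A x = y) ->
  invertible A.
Proof.
move=> bA injA surjA.
have [|C C0 hC] := open_mapping bA bounded_id.
  by move=> u _; apply: surjA.
have [g gK] := choice surjA.
have Kg : cancel A g by move=> x; apply: injA; rewrite gK.
have lg : linear g by apply: can2_linear Kg gK.
pose G := GRing.isLinear.Build _ _ _ _ g lg.
pose g' : {linear X -> X} := HB.pack g G.
exists g'; split => //.
apply: (@rnorm_bounded_operator _ C) => y.
have [x hx nx] := hC y (surjA y).
by rewrite (_ : g' y = x) // -[LHS]/(g y); apply: injA; rewrite gK.
Qed.

Lemma invertible_bound A : invertible A ->
  (forall y, exists x, A x = y) /\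
  exists2 L : R, 0 <= L & forall x, rnorm x <= L * rnorm (A x).
Proof.
move=> [B [/bounded_operatorP[L L0 hL] AK BK]]; split.
  by move=> y; exists (B y).
by exists L => // x; have := hL (A x); rewrite AK.
Qed.

(** [iter n S] carrying its linear structure. *)
Fixpoint power_op S n : {linear X -> X} :=
  if n is m.+1 then (S \o power_op S m : {linear X -> X})
  else (idfun : {linear X -> X}).

Lemma power_opE S n x : power_op S n x = iter n S x.
Proof. by elim: n x => //= n IH x; rewrite IH. Qed.

Lemma power_opC S n x : power_op S n (S x) = S (power_op S n x).
Proof. by rewrite !power_opE -iterSr. Qed.

Lemma bounded_power S n : bounded_operator S -> bounded_operator (power_op S n).
Proof.
move=> bS; elim: n => [|n IH]; first exact: bounded_id.
exact: bounded_comp.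
Qed.

(** * The two conditions of uniform descent *)

Lemma quotient_dim0 (V W : set X) :
  (forall (a : R[i]) x, W x -> W (a *: x)) -> quotient_dim V W = 0%E -> V `<=` W.
Proof.
move=> WZ V0 x Vx; apply: contrapT => nWx.
suff : (1%:R%:E <= quotient_dim V W)%E by rewrite V0 lee_fin ler10.
apply: ereal_sup_ubound; exists 1%N => //=.
exists (fun _ => x); split => // c; rewrite big_ord1 => Wc i.
rewrite ord1; apply: contrapT => /eqP c0; apply: nWx.
by rewrite -[x]scale1r -(mulVf c0) -scalerA; apply: WZ.
Qed.

Lemma quotient_dim_sub (V W : set X) : V `<=` W -> quotient_dim V W = 0%E.
Proof.
move=> VW; apply/eqP; rewrite eq_le; apply/andP; split.
  apply: ge_ereal_sup => _ [[|n] /= [v [Vv free]] <-] //.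
  have := free (fun i => (i == ord0)%:R).
  rewrite big_ord_recl /= scale1r big1 ?addr0; last by move=> i _; rewrite scale0r.
  by move=> /(_ (VW _ (Vv _)) ord0) /eqP; rewrite eqxx oner_eq0.
apply: ereal_sup_ubound; exists 0%N => //=.
by exists (fun _ => 0); split => [[]|c _ []].
Qed.

Lemma power_range_op S n y :
  power_range S n y <-> exists x, power_op S n x = y.
Proof.
split=> [[x _ <-]|[x <-]]; first by exists x; rewrite power_opE.
by exists x => //; rewrite power_opE.
Qed.

Lemma range_norm_le S d (x : X) : range_norm S d (power_op S d x) <= rnorm x.
Proof.
apply: ge_inf; last by exists x => //=; rewrite power_opE.
by exists 0 => _ [z _ <-]; apply: rnorm_ge0.
Qed.

(** The pullback to [X] of the range of the restriction of [S] to [R(S^d)] is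
    closed, since [S^d] contracts the norm of [X] to the norm of [R(S^d)]. *)
Lemma descent_closed S d : range_closed_in S d.+1 d ->
  rclosed [set u | exists v, (S \o power_op S d) v = power_op S d u].
Proof.
move=> cl u hu; apply/(power_range_op S d.+1).
apply: cl => [|e e0]; first by apply/power_range_op; exists u.
have [z [v hv] nz] := hu e e0; exists (power_op S d z).
  by apply/(power_range_op S d.+1); exists v.
by rewrite -linearB; apply: le_lt_trans (range_norm_le _ _ _) nz.
Qed.

Lemma descent_kernel S d :
  (forall n, (d <= n)%N -> descent_dim n S = 0%E) ->
  forall y, power_range S d y -> S y = 0 ->
  forall n, (d <= n)%N -> power_range S n y.
Proof.
move=> h y hy Sy n /subnK <-; elim: (n - d)%N => // k IH.
have WZ (a : R[i]) x : (power_range S (k + d).+1 `&` null_space S) x ->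
    (power_range S (k + d).+1 `&` null_space S) (a *: x).
  move=> [/power_range_op[z <-] Sx]; split.
    by apply/power_range_op; exists (a *: z); rewrite linearZ.
  by rewrite /null_space /= linearZ /= Sx scaler0.
by have [] := quotient_dim0 WZ (h (k + d)%N (leq_addl _ _)) (conj IH Sy).
Qed.

(** * The punctured neighbourhood theorem *)

Section UniformDescent.
Variables (S : {linear X -> X}) (d : nat) (C : R).
Let D := power_op S d.
Hypotheses (bS : bounded_operator S) (C0 : 0 < C).
Hypothesis lift : forall u, (exists v, S (D v) = D u) ->
  exists2 v, S (D v) = D u & rnorm v <= C * rnorm u.
Hypothesis kernel_in_range : forall y, power_range S d y -> S y = 0 ->
  forall n, (d <= n)%N -> power_range S n y.

Let bD : bounded_operator D. Proof. exact: bounded_power. Qed.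

(** A preimage of a vector in the range of all powers is again such a vector:
    it differs from a preimage in [R(S^m)] by a kernel vector, and the
    kernel is in [R(S^m)]. *)
Let lift_core u : (forall n, power_range S n (D u)) ->
  exists v, [/\ S (D v) = D u, forall n, power_range S n (D v)
              & rnorm v <= C * rnorm u].
Proof.
move=> hu; have [|v hv nv] := lift (u := u).
  by have /power_range_op[v hv] := hu d.+1; exists v.
exists v; split => // n.
have [m [nm dm]] : exists m, (n <= m)%N /\ (d <= m)%N.
  by exists (maxn n d); rewrite leq_maxl leq_maxr.
suff /power_range_op[t <-] : power_range S m (D v).
  by rewrite -(subnK nm) addnC power_opE iterD; exists (iter (m - n) S t).
have /power_range_op[z hz] := hu m.+1.
have : power_range S m (D v - power_op S m z).
  apply: kernel_in_range => //.
    rewrite -(subnK dm) addnC power_opE iterD -power_opE.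
    apply/power_range_op; exists (v - iter (m - d) S z).
    by rewrite linearB power_opE.
  by rewrite linearB hv -hz subrr.
move=> /power_range_op[t ht]; apply/power_range_op; exists (t + z).
by rewrite linearD ht subrK.
Qed.

(** Let [x = a_0] and [S D a_(n+1) = D a_n] be a chain of growth [C^n].
    The partial sums [s_n] of the [mu^i a_i] satisfy
    [(S - mu) D s_(n+1) = - mu^(n+1) D a_n], which tends to 0.  So [D s_n] tends to 0
    when [S - mu] is invertible, while [s_n] stays within a multiple
    of [|mu|] of [x]. *)
Lemma kernel_bound (mu : R[i]) x (M : R) :
  (forall z, rnorm (D z) <= M * rnorm z) -> 0 <= M ->
  invertible (shift S mu) -> C * rnorm mu <= 2^-1 -> S (D x) = 0 ->
  rnorm (D x) <= 2 * M * C * rnorm x * rnorm mu.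
Proof.
move=> hM M0 /invertible_bound[_ [L L0 hL]] mus SDx.
have Dxn n : power_range S n (D x).
  have [dn|/ltnW nd] := leqP d n.
    by apply: kernel_in_range => //; apply/power_range_op; exists x.
  rewrite /D power_opE -(subnK nd) addnC iterD.
  by exists (iter (d - n) S x).
have next u : exists v, (forall n, power_range S n (D u)) ->
    [/\ S (D v) = D u, forall n, power_range S n (D v) & rnorm v <= C * rnorm u].
  have [hu|hu] := pselect (forall n, power_range S n (D u)); last first.
    by exists u => /hu.
  by have [v hv] := lift_core hu; exists v.
have [f hf] := choice next.
pose a n := iter n f x.
have ha n : forall k, power_range S k (D (a n)).
  by elim: n => [|n IH] //=; have [] := hf _ IH.
have Sa n : S (D (a n.+1)) = D (a n) by have [] := hf _ (ha n).
pose m := rnorm mu; have m0 : 0 <= m by apply: rnorm_ge0.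
have nmu n : rnorm (mu ^+ n) = m ^+ n.
  by rewrite /m /rnorm normrX (rnormE mu) -rmorphXn.
have step n : m ^+ n.+1 * rnorm (a n.+1) <= C * m * (m ^+ n * rnorm (a n)).
  have [_ _ h] := hf _ (ha n); rewrite exprS [C * m]mulrC -!mulrA ler_wpM2l //.
  by rewrite mulrCA ler_wpM2l ?exprn_ge0.
have na n : rnorm (mu ^+ n *: a n) <= rnorm x * 2^-1 ^+ n.
  rewrite rnormZ nmu; elim: n => [|n IH]; first by rewrite !expr0 mul1r mulr1.
  apply: le_trans (step n) _; rewrite exprS [leRHS]mulrCA.
  by apply: ler_pM; rewrite ?mulr_ge0 ?(ltW C0) ?rnorm_ge0 ?exprn_ge0.
have na1 n : rnorm (mu ^+ n.+1 *: a n.+1) <= C * m * rnorm x * 2^-1 ^+ n.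
  rewrite rnormZ nmu; apply: le_trans (step n) _.
  rewrite -(mulrA _ (rnorm x)) ler_wpM2l ?mulr_ge0 ?(ltW C0) //.
  by have := na n; rewrite rnormZ nmu.
pose s n := \sum_(i < n) mu ^+ i *: a i.
have sS n : s n.+1 = s n + mu ^+ n *: a n by rewrite /s big_ord_recr.
have s0 : s 0%N = 0 by rewrite /s big_ord0.
have Ss n : S (D (s n.+1)) = mu *: D (s n).
  elim: n => [|n IH].
    by rewrite sS s0 add0r expr0 scale1r SDx linear0 scaler0.
  rewrite sS linearD linearD IH linearZ linearZ /= Sa sS linearD scalerDr linearZ.
  by rewrite scalerA -exprS.
have res n : shift S mu (D (s n.+1)) = - mu *: D (mu ^+ n *: a n).
  have Ds : D (s n.+1) = D (s n) + D (mu ^+ n *: a n) by rewrite sS linearD.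
  by rewrite shiftE Ss -scalerBr Ds opprD addrA subrr add0r scalerN scaleNr.
have nDs n : rnorm (D (s n.+1)) <= L * m * M * rnorm x * 2^-1 ^+ n.
  apply: le_trans (hL _) _; rewrite res rnormZ.
  rewrite (_ : rnorm (- mu) = m); last by rewrite /m /rnorm normrN.
  rewrite -!mulrA ler_wpM2l // ler_wpM2l //.
  by apply: le_trans (hM _) _; rewrite ler_wpM2l.
have dist n : rnorm (x - s n.+1) <= 2 * (C * m * rnorm x) * (1 - 2^-1 ^+ n).
  elim: n => [|n IH].
    by rewrite sS s0 add0r expr0 scale1r !subrr mulr0 rnorm0.
  rewrite sS opprD addrA; apply: le_trans (ler_rnormB _ _) _.
  by apply: le_trans (lerD IH (na1 n)) _; rewrite exprS; lra.
apply: (@ler_half_pow _ _ _ (L * m * M * rnorm x)) => n.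
have -> : D x = D (x - s n.+1) + D (s n.+1) by rewrite linearB subrK.
apply: le_trans (ler_rnormD _ _) _; apply: lerD => //.
have -> : 2 * M * C * rnorm x * rnorm mu = M * (2 * (C * m * rnorm x)).
  by rewrite /m; ring.
apply: le_trans (hM _) _; apply: ler_wpM2l => //.
apply: le_trans (dist n) _; apply: ler_piMr.
  by rewrite !mulr_ge0 ?rnorm_ge0 // ltW.
by rewrite gerBl exprn_ge0 // invr_ge0.
Qed.

Hypothesis resolvent_near : forall e : R, 0 < e ->
  exists2 mu : R[i], rnorm mu < e & invertible (shift S mu).

Lemma restriction_injective x : S (D x) = 0 -> D x = 0.
Proof.
move=> SDx; have /bounded_operatorP[M M0 hM] := bD.
apply/rnorm_eq0/le_anti; rewrite rnorm_ge0 andbT.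
apply/ler_addgt0Pr => e e0; rewrite add0r.
pose k := 2 * M * C * rnorm x.
have k0 : 0 <= k by rewrite !mulr_ge0 ?rnorm_ge0 // ltW.
have e'0 : 0 < Num.min (e / (k + 1)) ((2 * C)^-1).
  by rewrite lt_min divr_gt0 ?invr_gt0 ?mulr_gt0 // ltr_wpDl.
have [mu] := resolvent_near e'0; rewrite lt_min => /andP[mu1 mu2] imu.
have h : C * rnorm mu <= 2^-1.
  by rewrite mulrC -ler_pdivlMr // -invfM ltW.
apply: le_trans (kernel_bound hM M0 imu h SDx) _; rewrite -/k.
apply: le_trans (_ : (k + 1) * rnorm mu <= _).
  by rewrite ler_wpM2r ?rnorm_ge0 // lerDl.
by rewrite mulrC -ler_pdivlMr ?ltW // ltr_wpDl.
Qed.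

(** The restriction of [S] to [R(S^d)] being injective, the solution supplied by
    [lift] represents [D u] itself. *)
Lemma restriction_bounded_below u w : D (S u) = D w ->
  exists2 v, D v = D u & rnorm v <= C * rnorm w.
Proof.
move=> h; have [|v hv nv] := lift (u := w); first by exists u; rewrite -h power_opC.
exists v => //; apply/eqP; rewrite -subr_eq0 -linearB; apply/eqP.
by apply: restriction_injective; rewrite linearB linearB hv -h power_opC subrr.
Qed.

(** The restrictions of all [S - mu] with [|mu| <= 1 / (4 C)] are bounded below,
    uniformly.  The infimum of the norms of the representatives of [D u] is at
    most [4/3 C K]; as it need not be attained, a strictly larger bound is
    stated, and [K > 0] leaves room for this when [w = 0]. *)
Lemma shift_restriction_bounded_below (mu : R[i]) (K : R) u w :
  C * rnorm mu <= 4^-1 -> 0 < K -> rnorm w <= K -> D (shift S mu u) = D w ->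
  exists2 v, D v = D u & rnorm v <= 2 * C * K.
Proof.
move=> mus K0 wK h.
have CK0 : 0 < C * K by rewrite mulr_gt0.
(* Replacing a representative [v] of [D u] by a preimage of [w + mu v]
   quarters the part of its norm in excess of [4/3 C K]. *)
have approx n : exists2 v, D v = D u &
    rnorm v <= 4 / 3 * (C * K) + rnorm u * 2^-1 ^+ n.
  elim: n => [|n [v hv nv]].
    by exists u => //; rewrite expr0 mulr1 lerDr mulr_ge0 ?(ltW CK0) // divr_ge0.
  have [|v' hv' nv'] := @restriction_bounded_below u (w + mu *: v).
    by rewrite linearD -h linearZ hv -linearZ -linearD shiftE subrK.
  exists v' => //; apply: le_trans nv' _.
  apply: le_trans (_ : C * (K + rnorm mu * rnorm v) <= _).
    rewrite ler_wpM2l ?(ltW C0) //; apply: le_trans (ler_rnormD _ _) _.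
    by rewrite rnormZ lerD2r.
  rewrite mulrDr mulrA.
  have h1 : C * rnorm mu * rnorm v <= 4^-1 * rnorm v.
    by rewrite ler_wpM2r ?rnorm_ge0.
  have u0 : 0 <= rnorm u * 2^-1 ^+ n.
    by rewrite mulr_ge0 ?rnorm_ge0 ?exprn_ge0 ?invr_ge0.
  rewrite exprS mulrCA; lra.
have [n hn] : exists n, rnorm u * 2^-1 ^+ n <= 2 / 3 * (C * K).
  apply: contrapT => hn; have : 2 / 3 * (C * K) <= 0.
    apply: (@ler_half_pow _ _ _ (rnorm u)) => n; rewrite add0r leNgt.
    by apply/negP => /ltW ?; apply: hn; exists n.
  by move=> ?; lra.
by have [v hv nv] := approx n; exists v => //; lra.
Qed.

(** By induction on [n]: [mu z = S z - (S - mu) z], and a lower power of [S]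
    kills [S z]. *)
Lemma nilpotent_in_range (mu : R[i]) n z : mu != 0 -> power_op S n z = 0 ->
  exists t, shift S mu t = z.
Proof.
move=> mu0; elim: n z => [z z0|n IH z hz].
  by exists 0; rewrite linear0; apply: esym z0.
have [|t ht] := IH (S z); first by rewrite power_opC.
exists (mu^-1 *: (t - z)); rewrite linearZ linearB ht shiftE opprB addrC subrK /=.
by rewrite scalerA mulVf // scale1r.
Qed.

(** Injectivity: an eigenvector for [mu <> 0] lies in [R(S^d)].  Surjectivity:
    solve modulo [N(S^d)] by perturbing an invertible [S - mu1], then correct
    by an element obtained from [nilpotent_in_range]. *)
Lemma shift_invertible (mu : R[i]) : mu != 0 -> 8 * C * rnorm mu <= 1 ->
  invertible (shift S mu).
Proof.
move=> mu0 mus; have mus4 : C * rnorm mu <= 4^-1.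
  by have := mulr_ge0 (ltW C0) (rnorm_ge0 mu); lra.
have /bounded_operatorP[M M0 hM] := bD.
apply: bounded_inverse; first exact: bounded_shift.
- suff ker0 u : shift S mu u = 0 -> u = 0.
    move=> x y /eqP; rewrite -subr_eq0 -linearB => /eqP/ker0/eqP.
    by rewrite subr_eq0 => /eqP.
  move=> hu; have Du0 : D u = 0.
    apply/rnorm_eq0/le_anti; rewrite rnorm_ge0 andbT.
    apply: (@ler_half_pow _ _ _ (M * (2 * C))) => n; rewrite add0r.
    have e0 : 0 < 2^-1 ^+ n :> R by rewrite exprn_gt0 // invr_gt0.
    have [||v <- nv] := shift_restriction_bounded_below (w := 0) (u := u) mus4 e0.
    - by rewrite rnorm0 ltW.
    - by rewrite hu.
    by apply: le_trans (hM _) _; rewrite -(mulrA M) ler_wpM2l.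
  have Su : S u = mu *: u by apply/eqP; rewrite -subr_eq0 -shiftE hu.
  have pow n : power_op S n u = mu ^+ n *: u.
    elim: n => [|n IH]; first by rewrite expr0 scale1r.
    by rewrite /= IH linearZ /= Su scalerA -exprSr.
  by move/eqP: Du0; rewrite /D pow scaler_eq0 expf_eq0 (negPf mu0) andbF => /eqP.
have [|mu1 hmu1 /invertible_bound[surj1 _]] := resolvent_near (e := (8 * C)^-1).
  by rewrite invr_gt0 mulr_gt0.
have mus1 : 8 * C * rnorm mu1 <= 1.
  by rewrite mulrC -ler_pdivlMr ?mulr_gt0 // mul1r ltW.
have mus14 : C * rnorm mu1 <= 4^-1.
  by have := mulr_ge0 (ltW C0) (rnorm_ge0 mu1); lra.
(* The perturbation has norm at most [|mu| + |mu1| <= 1 / (4 C)], and the inverse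
   at [mu1] has norm at most [2 C] modulo [N(S^d)]: each step halves the error. *)
have step (K : R) u : 0 < K -> setT u -> rnorm u <= K ->
    exists v u' : X, [/\ rnorm v <= 2 * C * K, setT u', rnorm u' <= K / 2
      & (D \o shift S mu) v = D (u - u')].
  move=> K0 _ uK; have [w hw] := surj1 u.
  have [|v hv nv] := shift_restriction_bounded_below (u := w) mus14 K0 uK.
    by rewrite hw.
  exists v, ((mu - mu1) *: v); split => //.
    rewrite rnormZ; have h1 : rnorm (mu - mu1) <= rnorm mu + rnorm mu1.
      by have := ler_normB mu mu1; rewrite !rnormE -rmorphD lecR.
    have h2 : rnorm (mu - mu1) * (2 * C) <= 2^-1.
      by apply: le_trans (ler_wpM2r _ h1) _; rewrite ?mulr_ge0 ?(ltW C0) //; lra.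
    apply: le_trans (ler_wpM2l (rnorm_ge0 _) nv) _.
    by rewrite mulrA mulrC ler_wpM2l // ltW.
  rewrite /= linearB -hw !shiftE !linearB !linearZ /= !power_opC hv scalerBl.
  by rewrite !scalerN opprK [- (mu *: _) + _]addrC addrA subrK.
move=> y.
have K0 : 0 < rnorm y + 1 by rewrite ltr_wpDl ?rnorm_ge0.
have [||w hw _] := successive_approximation (bounded_comp bD (bounded_shift mu bS))
   bD _ step K0 (I : setT y).
- by rewrite mulr_ge0 // ltW.
- by rewrite lerDl.
have [|t ht] := @nilpotent_in_range mu d (y - shift S mu w) mu0.
  by rewrite linearB -/D -hw subrr.
by exists (w + t); rewrite linearD ht addrC subrK.
Qed.

End UniformDescent.

Lemma uniform_descent_punctured S :
  bounded_operator S -> topological_uniform_descent S ->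
  (forall e : R, 0 < e ->
     exists2 mu : R[i], rnorm mu < e & invertible (shift S mu)) ->
  exists2 r : R, 0 < r &
    forall mu : R[i], mu != 0 -> rnorm mu < r -> invertible (shift S mu).
Proof.
move=> bS [d [hk hc]] near.
have [|C C0 hC] := open_mapping (bounded_comp bS (bounded_power d bS))
  (bounded_power d bS).
  by apply: descent_closed; apply: hc.
exists (8 * C)^-1; first by rewrite invr_gt0 mulr_gt0.
move=> mu mu0 hmu; apply: (shift_invertible bS C0 hC (descent_kernel hk) near) => //.
by rewrite mulrC -ler_pdivlMr ?mulr_gt0 // mul1r ltW.
Qed.

(** * Operators that are bounded below or onto *)

Lemma bounded_belowP A : bounded_below A ->
  exists2 c : R, 0 < c & forall x, c * rnorm x <= rnorm (A x).
Proof.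
by move=> [c c0 h]; exists c => // x; have := h x; rewrite !rnormE -rmorphM lecR.
Qed.

Lemma invertible_bounded_below A : invertible A -> bounded_below A.
Proof.
move=> /invertible_bound[_ [L L0 hL]]; have L1 : 0 < L + 1 by rewrite ltr_wpDl.
exists (L + 1)^-1; first by rewrite invr_gt0.
move=> x; rewrite !rnormE -rmorphM lecR ler_pdivrMl //.
by apply: le_trans (hL x) _; rewrite ler_wpM2r ?rnorm_ge0 // lerDl.
Qed.

(** Preimages of a sequence converging to [y] form a Cauchy sequence. *)
Lemma bounded_below_range_closed A :
  bounded_operator A -> bounded_below A -> rclosed (range A).
Proof.
move=> /bounded_operatorP[M M0 hM] /bounded_belowP[c c0 hc] y hy.
have next n : exists x, rnorm (y - A x) < 2^-1 ^+ n.
  have [|_ [x _ <-] h] := hy (2^-1 ^+ n); first by rewrite exprn_gt0 // invr_gt0.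
  by exists x.
have [s hs] := choice next.
have [|l hl] := @geometric_limit s (2 / c).
  move=> n; rewrite mulrAC ler_pdivlMr // mulrC; apply: le_trans (hc _) _.
  have -> : A (s n.+1 - s n) = (y - A (s n)) - (y - A (s n.+1)).
    by rewrite linearB opprB [RHS]addrC subrKA.
  apply: le_trans (ler_rnormB _ _) _.
  have := hs n; have := hs n.+1; rewrite exprS.
  have : 0 < 2^-1 ^+ n :> R by rewrite exprn_gt0 // invr_gt0.
  lra.
exists l => //; apply/eqP; rewrite -subr_eq0; apply/eqP/rnorm_eq0/le_anti.
rewrite rnorm_ge0 andbT; apply: (@ler_half_pow _ _ _ (M * (2 * (2 / c)) + 1)) => n.
have -> : A l - y = A (l - s n) - (y - A (s n)) by rewrite linearB opprB subrKA.
rewrite add0r mulrDl; apply: le_trans (ler_rnormB _ _) _; apply: lerD.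
  by apply: le_trans (hM _) _; rewrite -mulrA ler_wpM2l.
by rewrite mul1r ltW.
Qed.

Lemma bounded_below_power S n : bounded_below S -> bounded_below (power_op S n).
Proof.
move=> /bounded_belowP[c c0 hc]; exists (c ^+ n); first by rewrite exprn_gt0.
move=> x; rewrite !rnormE -rmorphM lecR; elim: n => [|n IH] /=.
  by rewrite expr0 mul1r.
by apply: le_trans (hc _); rewrite exprS -mulrA ler_wpM2l // ltW.
Qed.

Lemma bounded_below_uniform_descent S :
  bounded_operator S -> bounded_below S -> topological_uniform_descent S.
Proof.
move=> bS lS; exists 0%N; split=> [n _|n _ y _ hy].
  apply: quotient_dim_sub => x [_ Sx]; suff -> : x = 0.
    split; last exact: linear0.
    by apply/power_range_op; exists 0; rewrite linear0.
  have /bounded_belowP[c c0 hc] := lS; apply/rnorm_eq0/le_anti.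
  rewrite rnorm_ge0 andbT -(ler_pM2l c0) mulr0.
  by apply: le_trans (hc x) _; rewrite Sx rnorm0.
have E : power_range S n = range (power_op S n).
  by apply/seteqP; split=> z [x _ <-]; exists x; rewrite ?power_opE.
rewrite E; apply: (bounded_below_range_closed (bounded_power n bS)).
  exact: bounded_below_power.
move=> e e0; have [z hz nz] := hy e e0; exists z; first by rewrite -E.
(* For [d = 0] the range norm is the norm of [X]. *)
move: nz; rewrite /range_norm (_ : [set x | _] = [set y - z]); last first.
  by apply/seteqP; split=> x /=.
by rewrite image_set1 inf1.
Qed.

Lemma surjective_uniform_descent S :
  set_surj [set: X] [set: X] S -> topological_uniform_descent S.
Proof.
move=> sS; have all_range n y : power_range S n y.
  elim: n y => [|n IH] y; first by exists y.
  have [x _ <-] := sS y I; have [z _ <-] := IH x.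
  by exists z.
by exists 0%N; split=> [n _|n _ y _ _] //; apply: quotient_dim_sub => x [].
Qed.

(** * Boundary points of the spectrum *)

Lemma shift_shift S (lam mu : R[i]) x :
  shift (shift S lam) mu x = shift S (lam + mu) x.
Proof. by rewrite !shiftE scalerDl opprD addrA. Qed.

Lemma eq_invertible A D : A =1 D -> invertible A -> invertible D.
Proof.
move=> e [B [bB AK BK]]; exists B; split=> // x; first by rewrite -e AK.
by rewrite -e BK.
Qed.

Lemma boundary_not_uniform_descent (T : {linear X -> X}) (lam : complex_field R) :
  bounded_operator T -> boundary (spectrum T) lam -> spectrum T lam ->
  ~ isolated (spectrum T) lam -> TUD_spectrum T lam.
Proof.
move=> bT [_ nint] slam niso tud; apply: niso.
have [|r r0 hr] := uniform_descent_punctured (bounded_shift lam bT) tud.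
  move=> e e0; apply: contrapT => hno; apply: nint; apply/nbhs_ballP.
  exists e%:C => /=; first by rewrite ltcR.
  move=> mu /=; rewrite -ball_normE /= => hmu imu; apply: hno.
  exists (mu - lam).
    by move: hmu; rewrite distrC rnormE ltcR.
  apply: eq_invertible imu => x.
  by rewrite shift_shift addrC subrK.
split; first by rewrite inE.
exists (ball lam r%:C); first by apply: nbhsx_ballx; rewrite ltcR.
apply/seteqP; split=> [mu [] /=|mu ->]; last first.
  by split=> //; apply: ballxx; rewrite ltcR.
rewrite -ball_normE /= distrC rnormE ltcR => hmu smu.
apply: contrapT => ne; apply: smu.
have ne0 : mu - lam != 0 by rewrite subr_eq0; apply/eqP.
apply: eq_invertible (hr _ ne0 hmu) => x.
by rewrite shift_shift addrC subrK.
Qed.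

End Operators.

Unset Implicit Arguments.

Theorem corollary4p9 (R : realType) (X : completeNormedModType R[i])
  (hX : infinite_dimensional X) :
  (forall T : {linear X -> X}, bounded_operator T ->
     approximate_point_spectrum T = boundary (spectrum T) ->
     (forall lambda : complex_field R, boundary (spectrum T) lambda ->
        ~ isolated (spectrum T) lambda) ->
     approximate_point_spectrum T = TUD_spectrum T)
  /\
  (forall T : {linear X -> X}, bounded_operator T ->
     surjective_spectrum T = boundary (spectrum T) ->
     (forall lambda : complex_field R, boundary (spectrum T) lambda ->
        ~ isolated (spectrum T) lambda) ->
     surjective_spectrum T = TUD_spectrum T).
Proof.
split=> T bT bd niso; apply/seteqP; split=> lam.
- move=> nbb; have blam : boundary (spectrum T) lam by rewrite -bd.
  apply: boundary_not_uniform_descent (niso _ blam) => //.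
  by move=> /invertible_bounded_below.
- move=> ntud bb; apply: ntud; apply: bounded_below_uniform_descent bb.
  exact: bounded_shift.
- move=> nsu; have blam : boundary (spectrum T) lam by rewrite -bd.
  apply: boundary_not_uniform_descent (niso _ blam) => //.
  move=> /invertible_bound[su _]; apply: nsu => y _.
  by have [x hx] := su y; exists x.
- by move=> ntud su; apply: ntud; apply: surjective_uniform_descent.
Qed.
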